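(* Let $\beta\geq 2$ be an integer. If $k\in\mathbb{N}$ is sufficiently large, then (i) $p_k(r_{k,\mathrm{max}})>0$; (ii) $p_k(r_{k,\mathrm{min}})<0$; (iii) $r_{k,\mathrm{min}}<r_{k,1}<r_{k,\mathrm{max}}$.
   Context: For integers $\beta\geq 2$ and $k\geq 2$ let \[ p_k(x)=x^k-(\beta-1)\sum_{i=0}^{k-1}x^i, \] and let $r_{k,1}$ denote the unique root of $p_k$ in the interval $(1,\beta)$ (the other roots of $p_k$ lie strictly inside the unit circle of the complex plane). Define \[ r_{k,\mathrm{min}}=\beta-\frac{\beta-1}{\beta^k-1}\big(1+\beta^{-k/2}\big),\qquad r_{k,\mathrm{max}}=\beta-\frac{\beta-1}{\beta^k-1}. \] *)

(* Defs.v *)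
From HB Require Import structures.
From mathcomp Require Import all_boot all_order all_algebra.
From mathcomp Require Import all_classical all_reals all_analysis.
Set Implicit Arguments.
Unset Strict Implicit.
Unset Printing Implicit Defensive.
Import Order.TTheory GRing.Theory Num.Theory.
Local Open Scope classical_set_scope.
Local Open Scope ring_scope.

Definition pk (R : realType) (beta k : nat) : {poly R} :=
  'X^k - (beta%:R - 1) *: \sum_(i < k) 'X^i.

(* Definite description: the default value 0 is returned unless [pk R beta k]
   has exactly one root in the open interval (1, beta). *)
Definition rk1 (R : realType) (beta k : nat) : R :=
  xget 0 [set r : R | unique
    (fun x : R => 1 < x < beta%:R /\ root (pk R beta k) x) r].

Definition rkmin (R : realType) (beta k : nat) : R :=
  beta%:R - (beta%:R - 1) / (beta%:R ^+ k - 1)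
            * (1 + beta%:R `^ (- (k%:R / 2))).

Definition rkmax (R : realType) (beta k : nat) : R :=
  beta%:R - (beta%:R - 1) / (beta%:R ^+ k - 1).

(* Main.v *)
Require Import Defs.
From mathcomp Require Import all_boot all_order all_algebra.
From mathcomp Require Import all_classical all_reals all_analysis.
From mathcomp Require Import ring lra zify.
Import Order.TTheory GRing.Theory Num.Theory.
Local Open Scope ring_scope.

(** Summing the geometric series gives
    [(x - 1) p_k(x) = (beta - 1) - (beta - x) x^k], so for [x > 1] the sign of
    [p_k(x)] is decided by comparing [x^k] with [(beta - 1) / (beta - x)].

    At [r_max] this quotient is [beta^k - 1], which is also the height at
    [r_max] of the chord of [t |-> t^k] through [(1, 1)] and [(beta, beta^k)].
    Strict convexity ([expr_lt_chord]) puts [r_max^k] below that chord, whence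
    [p_k(r_max) > 0]; this needs only [k >= 2].

    At [r_min], with [e = beta^(-k/2)], the quotient is
    [(beta^k - 1) / (1 + e)].  Bernoulli's inequality shows that [r_min^k] loses
    at most [4 k] compared with [beta^k], whereas the factor [1 + e] gains
    [e beta^k = 1 / e = beta^(k/2)].  The exponential gain wins as soon as
    [8 k <= beta^(k/2)], which holds for [k >= 16], whence [p_k(r_min) < 0].

    Finally [p_k(x) / x^k = 1 - (beta - 1) (x^-1 + ... + x^-k)] increases with
    [x > 0] ([pk_increasing]), so [p_k] changes sign at most once there.  The
    root given by the intermediate value theorem between [r_min] and [r_max] is
    thus the only root in [(1, beta)]. *)

Lemma horner_pk (R : realType) (beta k : nat) (x : R) :
  (pk R beta k).[x] = x ^+ k - (beta%:R - 1) * \sum_(i < k) x ^+ i.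
Proof.
rewrite /pk hornerD hornerN hornerZ hornerXn horner_sum.
by under eq_bigr do rewrite hornerXn.
Qed.

Lemma mul_subr1_pk (R : realType) (beta k : nat) (x : R) :
  (x - 1) * (pk R beta k).[x] = (beta%:R - 1) - (beta%:R - x) * x ^+ k.
Proof.
have := subrX1 x k; rewrite horner_pk.
set S := \sum_(i < k) _ => hS.
have -> : x ^+ k = 1 + (x - 1) * S by rewrite -hS; ring.
by ring.
Qed.

(** This is the monotonicity of [p_k(x) / x^k] on the positive axis, with the
    denominators cleared. *)
Lemma pk_increasing (R : realType) (beta k : nat) (x y : R) :
  (1 < beta)%N -> (0 < k)%N -> 0 < x -> x < y ->
  y ^+ k * (pk R beta k).[x] < x ^+ k * (pk R beta k).[y].
Proof.
move=> beta_gt1 k_gt0 x_gt0 xy; have y_gt0 := lt_trans x_gt0 xy.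
have b_gt1 : 1 < beta%:R :> R by rewrite ltr1n.
have lt_sum : x ^+ k * \sum_(i < k) y ^+ i < y ^+ k * \sum_(i < k) x ^+ i.
  rewrite !mulr_sumr; apply: ltr_sum; first by apply/hasP; exists (Ordinal k_gt0).
  move=> [i /= i_lt_k] _; rewrite -(subnK (ltnW i_lt_k)) !exprD -!mulrA.
  rewrite (mulrC (y ^+ i)) ltr_pM2r ?mulr_gt0 ?exprn_gt0 //.
  by rewrite ltrXn2r ?subn_eq0 -?ltnNge // ?ltW.
rewrite !horner_pk; nra.
Qed.

(** Strict convexity of the power function: on [(1, b)] it lies below its chord
    over [[1, b]]. *)
Lemma expr_lt_chord (R : realFieldType) (b x : R) (k : nat) :
  1 < x -> x < b -> (1 < k)%N ->
  (b - 1) * x ^+ k < (x - 1) * b ^+ k + (b - x).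
Proof.
move=> x_gt1 xb; have b_gt1 := lt_trans x_gt1 xb.
(* Passing from k to k + 1 multiplies the bound by x, and the new chord exceeds
   the result by (x - 1) (b - x) (b^k - 1). *)
have step m : (0 < m)%N ->
    x * ((x - 1) * b ^+ m + (b - x)) < (x - 1) * b ^+ m.+1 + (b - x).
  move=> m_gt0; rewrite -subr_gt0 exprS.
  have -> : (x - 1) * (b * b ^+ m) + (b - x) - x * ((x - 1) * b ^+ m + (b - x))
            = (x - 1) * (b - x) * (b ^+ m - 1) by ring.
  by rewrite !mulr_gt0 ?subr_gt0 // exprn_egt1 // -lt0n.
case: k => [|[|k]] // _; elim: k => [|k IHk].
  by have := step 1%N isT; rewrite !expr2 !expr1; apply: le_lt_trans; lra.
apply: lt_trans (step k.+2 isT).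
by rewrite exprS mulrCA ltr_pM2l // (lt_trans ltr01).
Qed.

Lemma bernoulli_ineq (R : realFieldType) (u : R) (k : nat) :
  0 <= u <= 1 -> 1 - k%:R * u <= (1 - u) ^+ k.
Proof.
move=> /andP[u_ge0 u_le1]; elim: k => [|k IHk]; first by rewrite expr0; lra.
have k_ge0 : 0 <= k%:R :> R by [].
rewrite exprS -natr1.
have : (1 - u) * (1 - k%:R * u) <= (1 - u) * (1 - u) ^+ k.
  by rewrite ler_wpM2l // subr_ge0.
nra.
Qed.

Lemma rkmax_bounds (R : realType) (beta k : nat) :
  (1 < beta)%N -> (1 < k)%N -> 1 < rkmax R beta k < beta%:R.
Proof.
move=> beta_gt1 k_gt1; rewrite /rkmax; set b : R := beta%:R.
have b_ge2 : 2 <= b by rewrite ler_nat.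
have bk_ge4 : 4 <= b ^+ k.
  apply: (@le_trans _ _ (b ^+ 2)); first nra.
  by rewrite ler_weXn2l //; lra.
have d_gt0 : 0 < (b - 1) / (b ^+ k - 1) by rewrite divr_gt0 //; lra.
have d_lt : (b - 1) / (b ^+ k - 1) < b - 1 by rewrite ltr_pdivrMr; nra.
by apply/andP; split; lra.
Qed.

Lemma pk_rkmax_gt0 (R : realType) (beta k : nat) :
  (1 < beta)%N -> (1 < k)%N -> 0 < (pk R beta k).[rkmax R beta k].
Proof.
move=> beta_gt1 k_gt1.
have /andP[x_gt1 x_ltb] := @rkmax_bounds R beta k beta_gt1 k_gt1.
rewrite -(@pmulr_rgt0 _ (rkmax R beta k - 1)) ?subr_gt0 // mul_subr1_pk.
have := expr_lt_chord _ _ _ k x_gt1 x_ltb k_gt1.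
have : (beta%:R - rkmax R beta k) * (beta%:R ^+ k - 1) = beta%:R - 1.
  rewrite /rkmax subKr divfK // gt_eqF // subr_gt0.
  by rewrite exprn_egt1 ?ltr1n // -lt0n ltnW.
move: (rkmax R beta k) x_gt1 x_ltb => x x_gt1 x_ltb.
set b : R := beta%:R in x_ltb *; set M := b ^+ k; set X := x ^+ k => hM hX.
have b1_gt0 : 0 < b - 1 by lra.
have bx_gt0 : 0 < b - x by lra.
suff hXM : X < M - 1 by rewrite subr_gt0 -hM ltr_pM2l.
rewrite -(ltr_pM2l b1_gt0); nra.
Qed.

(** Since [b - x] is [(b - 1) (1 + e) / (b^k - 1)], the second inequality
    amounts to [b^k - 1 < (1 + e) x^k]: the gain [e b^k = 1 / e] from the factor [1 + e] has
    to beat the loss from Bernoulli's inequality applied to [(x / b)^k].  The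
    bound [1 < x] lets the sign pass to [p_k] through [mul_subr1_pk]. *)
Lemma rkmin_bounds (R : realFieldType) (b e : R) (k : nat) :
  2 <= b -> 0 < e -> e ^+ 2 * b ^+ k = 1 -> 8 * k%:R * e <= 1 -> (1 < k)%N ->
  let x := b - (b - 1) / (b ^+ k - 1) * (1 + e) in
  1 < x < b /\ b - 1 < (b - x) * x ^+ k.
Proof.
move=> b_ge2 e_gt0 he hke k_gt1 x; rewrite {}/x.
have k_ge2 : 2 <= k%:R :> R by rewrite ler_nat.
have M_ge4 : 4 <= b ^+ k.
  apply: (@le_trans _ _ (b ^+ 2)); first nra.
  by rewrite ler_weXn2l //; lra.
have e_le1 : e <= 1 by nra.
set M := b ^+ k in he M_ge4 *.
have N_gt0 : 0 < M - 1 by lra.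
set d := (b - 1) / (M - 1) * (1 + e).
have hd : d * (M - 1) = (b - 1) * (1 + e).
  by rewrite /d mulrAC divfK // gt_eqF.
have d_gt0 : 0 < d by rewrite !mulr_gt0 ?invr_gt0 //; lra.
have d_lt : d < b - 1 by rewrite -(ltr_pM2r N_gt0) hd; nra.
split; first by apply/andP; split; lra.
rewrite subKr.
have b_neq0 : b != 0 by rewrite gt_eqF //; lra.
have b_gt0 : 0 < b by lra.
pose u := d / b.
have hu : u * b = d by rewrite divfK.
have u_ge0 : 0 <= u by rewrite divr_ge0 // ltW.
have u_le1 : u <= 1 by rewrite ler_pdivrMr //; lra.
have Mu_le4 : M * u <= 4.
  have Md_le : M * d <= 2 * (d * (M - 1)) by nra.
  by rewrite mulrA ler_pdivrMr //; nra.
have -> : b - d = b * (1 - u) by rewrite -hu; ring.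
rewrite exprMn -/M.
have power_ge : M - 4 * k%:R <= M * (1 - u) ^+ k.
  have u_in : 0 <= u <= 1 by rewrite u_ge0.
  have := bernoulli_ineq _ _ k u_in.
  move: ((1 - u) ^+ k) => X hX; nra.
move: (M * (1 - u) ^+ k) power_ge => X power_ge.
(* e M = 1 / e, in a form without division *)
have eM_ge : 8 * k%:R <= e * M.
  have eeM : e * (e * M) = 1 by rewrite mulrA -expr2.
  by rewrite -(ler_pM2l e_gt0) eeM; nra.
have XN : M - 1 < (1 + e) * X.
  have h : (1 + e) * (M - 4 * k%:R) <= (1 + e) * X by rewrite ler_pM2l //; lra.
  nra.
rewrite -(ltr_pM2r N_gt0) mulrAC hd -mulrA ltr_pM2l //; lra.
Qed.

Lemma sqr_leq_exp2 (k : nat) : (16 <= k)%N -> (64 * k ^ 2 <= 2 ^ k)%N.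
Proof.
move=> /subnK <-; elim: (k - 16)%N => [|n] //.
rewrite addSn (expnS 2); move: (leq_addl n 16) => m_ge16 IHm.
apply: (@leq_trans (2 * (64 * (n + 16) ^ 2))); last by rewrite leq_mul2l.
by rewrite -!mulnn; nia.
Qed.

Lemma rkmin_eps (R : realType) (beta k : nat) (e := beta%:R `^ (- (k%:R / 2)) : R) :
  (1 < beta)%N -> (16 <= k)%N ->
  [/\ 0 < e, e ^+ 2 * beta%:R ^+ k = 1 & 8 * k%:R * e <= 1].
Proof.
move=> beta_gt1 k_ge16.
have b_gt0 : 0 < beta%:R :> R by rewrite ltr0n ltnW.
have e_gt0 : 0 < e by exact: powR_gt0.
have he : e ^+ 2 * beta%:R ^+ k = 1.
  rewrite -powR_mulrn ?ltW // -powRrM -powR_mulrn ?ltW //.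
  rewrite mulNr divfK ?pnatr_eq0 // powRN mulVf // gt_eqF //.
  exact: powR_gt0.
split=> //.
have hk : 64 * k%:R ^+ 2 <= beta%:R ^+ k :> R.
  rewrite -!natrX -natrM ler_nat (leq_trans (@sqr_leq_exp2 k k_ge16)) //.
  by rewrite leq_exp2r // (leq_trans _ k_ge16).
have k8_ge0 : 0 <= 8 * k%:R * e by rewrite !mulr_ge0 ?ler0n ?(ltW e_gt0).
rewrite -(@expr_le1 _ 2) ?k8_ge0 // !exprMn -[leRHS]he.
rewrite mulrC ler_pM2l ?exprn_gt0 //.
by move: hk; rewrite expr2; lra.
Qed.

Lemma rkmin_gt1_pk_rkmin_lt0 (R : realType) (beta k : nat) :
  (1 < beta)%N -> (16 <= k)%N ->
  1 < rkmin R beta k /\ (pk R beta k).[rkmin R beta k] < 0.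
Proof.
move=> beta_gt1 k_ge16.
have [e_gt0 he hke] := @rkmin_eps R beta k beta_gt1 k_ge16.
have k_gt1 : (1 < k)%N by apply: leq_trans k_ge16.
have b_ge2 : 2 <= beta%:R :> R by rewrite ler_nat.
have [/andP[x_gt1 _]] :=
  rkmin_bounds _ _ _ _ b_ge2 e_gt0 he hke k_gt1.
rewrite -/(rkmin R beta k) in x_gt1 * => hx; split=> //.
by rewrite -(@pmulr_rlt0 _ (rkmin R beta k - 1)) ?subr_gt0 // mul_subr1_pk subr_lt0.
Qed.

Lemma pk_root_uniq (R : realType) (beta k : nat) (x y : R) :
  (1 < beta)%N -> (0 < k)%N -> 0 < x -> 0 < y ->
  root (pk R beta k) x -> root (pk R beta k) y -> x = y.
Proof.
move=> beta_gt1 k_gt0 x_gt0 y_gt0 /rootP px /rootP py.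
have no_lt u v : 0 < u -> u < v -> (pk R beta k).[u] = 0 ->
    (pk R beta k).[v] = 0 -> False.
  move=> u_gt0 uv pu pv.
  have := pk_increasing R beta k u v beta_gt1 k_gt0 u_gt0 uv.
  by rewrite pu pv !mulr0 ltxx.
by case: (ltgtP x y) => // [/no_lt|/no_lt] h; case: h.
Qed.

(** The default value of [rk1] is excluded as soon as one root in [(1, beta)]
    is known, since [pk_root_uniq] makes it unique. *)
Lemma rk1_eq (R : realType) (beta k : nat) (r : R) :
  (1 < beta)%N -> (0 < k)%N -> 1 < r < beta%:R -> root (pk R beta k) r ->
  rk1 R beta k = r.
Proof.
move=> beta_gt1 k_gt0 r_in pr; apply: xget_subset1 => [|x y [px ux] [py _]].
  split=> // s [/andP[s_gt1 _] ps]; have /andP[r_gt1 _] := r_in.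
  by apply: pk_root_uniq pr ps => //; apply: lt_trans ltr01 _.
exact: ux.
Qed.

Theorem lemma5p1 (R : realType) (beta : nat) (hbeta : (2 <= beta)%N) :
  exists K : nat, forall k : nat, (K <= k)%N ->
    [/\ 0 < (pk R beta k).[rkmax R beta k],
        (pk R beta k).[rkmin R beta k] < 0
      & rkmin R beta k < rk1 R beta k < rkmax R beta k].
Proof.
exists 16%N => k k_ge16; have k_gt1 : (1 < k)%N by apply: leq_trans k_ge16.
have pmax := @pk_rkmax_gt0 R beta k hbeta k_gt1.
have [min_gt1 pmin] := @rkmin_gt1_pk_rkmin_lt0 R beta k hbeta k_ge16.
have /andP[_ max_lt] := @rkmax_bounds R beta k hbeta k_gt1.
have [e_gt0 _ _] := @rkmin_eps R beta k hbeta k_ge16.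
have min_le_max : rkmin R beta k <= rkmax R beta k.
  rewrite /rkmin /rkmax lerD2l lerN2 ler_peMr ?lerDl ?ltW //.
  by rewrite divr_gt0 // subr_gt0 ?exprn_egt1 ?ltr1n // -lt0n ltnW.
split=> //.
have pminmax : (pk R beta k).[rkmin R beta k] <= 0 <= (pk R beta k).[rkmax R beta k].
  by rewrite !ltW.
have [r /andP[min_le le_max] pr] := poly_ivt min_le_max pminmax.
have min_lt : rkmin R beta k < r.
  by rewrite lt_neqAle min_le andbT; apply: contraTneq pr => <-; rewrite rootE lt_eqF.
have lt_max : r < rkmax R beta k.
  by rewrite lt_neqAle le_max andbT; apply: contraTneq pr => ->; rewrite rootE gt_eqF.
rewrite (@rk1_eq _ _ _ r) ?min_lt //; first exact: ltnW.
by rewrite (lt_trans min_gt1) // (lt_trans lt_max).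
Qed.
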